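(* Let $\Gamma;s$ be an extended context and $\lambda x\leq t.u$ a term. Then $\Gamma;s\vdash\top\leq^*_{\mathrm{wf}}\lambda x\leq t.u$ does not hold.
   Context: Terms: $t ::= x \mid \top \mid (\lambda x\leq t.u) \mid (u\,v)$, with $x$ from a countably infinite set of variables and $\top$ a constant; $x$ is bound in $u$ in $\lambda x\leq t.u$; terms identified up to renaming of bound variables; $\mathrm{fv}$ = free variables, $u[x:=v]$ = capture-avoiding substitution. Extended context $\Gamma;s$: a finite sequence $\Gamma$ of annotations $x\leq t$ and a finite list (stack) $s$ of terms; $\varepsilon;[]$ empty, $\Gamma,x\leq t;s$ appends an annotation, $\Gamma;\alpha::s$ pushes $\alpha$. $\mathrm{dom}(\Gamma)$ = annotated variables; $x\leq t\in\Gamma$ means the annotation occurs in $\Gamma$; ''$x$ has subtype $t$ in $\Gamma$'' means $x\leq t$ is the last annotation for $x$ in $\Gamma$. Prevalidity: least predicate with $\varepsilon;[]$ prevalid; $\Gamma,x\leq t;[]$ prevalid if $\Gamma;[]$ prevalid, $x\notin\mathrm{dom}(\Gamma)$, $\mathrm{fv}(t)\subseteq\mathrm{dom}(\Gamma)$; $\Gamma;\alpha::s$ prevalid if $\Gamma;s$ prevalid and $\mathrm{fv}(\alpha)\subseteq\mathrm{dom}(\Gamma)$. Equivalence reduction $\to_{\equiv}$: least relation with $x\to_{\equiv}x$; $\top\to_{\equiv}\top$; $\top\,u\to_{\equiv}\top$; if $u\to_{\equiv}u'$, $v\to_{\equiv}v'$ then $u\,v\to_{\equiv}u'\,v'$ and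 $(\lambda x\leq t.u)\,v\to_{\equiv}u'[x:=v']$; if $t\to_{\equiv}t'$, $u\to_{\equiv}u'$ then $\lambda x\leq t.u\to_{\equiv}\lambda x\leq t'.u'$. Subtyping reduction $\Gamma;s\vdash u\to_{\leq}v$: least relation with (Prom) $\Gamma;s$ prevalid and $x\leq t\in\Gamma$ give $\Gamma;s\vdash x\to_{\leq}t$; (Top) $\Gamma;s$ prevalid gives $\Gamma;s\vdash u\to_{\leq}\top$; (Eq) $\Gamma;s$ prevalid and $u\to_{\equiv}v$ give $\Gamma;s\vdash u\to_{\leq}v$; (App) $\Gamma;v::s\vdash u\to_{\leq}u'$ gives $\Gamma;s\vdash u\,v\to_{\leq}u'\,v$; (FunOp) $\Gamma,x\leq\alpha;s\vdash u\to_{\leq}u'$ gives $\Gamma;\alpha::s\vdash\lambda x\leq t.u\to_{\leq}\lambda x\leq t.u'$; (Fun) $\Gamma,x\leq t;[]\vdash u\to_{\leq}u'$ gives $\Gamma;[]\vdash\lambda x\leq t.u\to_{\leq}\lambda x\leq t.u'$. Subtyping: $\Gamma;s\vdash v\leq t$ is the least relation with: if $\Gamma;s$ prevalid then $\Gamma;s\vdash t\leq t$; if $\Gamma;s\vdash v\to_{\leq}v'$ and $\Gamma;s\vdash v'\leq t$ then $\Gamma;s\vdash v\leq t$; if $\Gamma;s\vdash v\leq t'$ and $t\to_{\equiv}t'$ then $\Gamma;s\vdash v\leq t$. Well-formedness $\Gamma;s\vdash t\ \mathrm{wf}$, well-subtyping $\leq_{\mathrm{wf}}$ and transitive well-subtyping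 $\leq^*_{\mathrm{wf}}$ are the least relations (defined simultaneously) with: (W-Var) if $\Gamma;s$ prevalid, $x$ has subtype $t$ in $\Gamma$ and $\Gamma;s\vdash t\ \mathrm{wf}$ then $\Gamma;s\vdash x\ \mathrm{wf}$; (W-Top) if $\Gamma;s$ prevalid then $\Gamma;s\vdash\top\ \mathrm{wf}$; (W-Fun) if $\Gamma,x\leq t;[]\vdash u\ \mathrm{wf}$ and $\Gamma;[]\vdash t\ \mathrm{wf}$ then $\Gamma;[]\vdash\lambda x\leq t.u\ \mathrm{wf}$; (W-FunOp) if $\Gamma,x\leq\delta;s\vdash u\ \mathrm{wf}$ and $\Gamma;[]\vdash t\ \mathrm{wf}$ then $\Gamma;\delta::s\vdash\lambda x\leq t.u\ \mathrm{wf}$; (W-App) if $\Gamma;v::s\vdash u\leq^*_{\mathrm{wf}}\lambda x\leq t.\top$ and $\Gamma;[]\vdash v\leq^*_{\mathrm{wf}}t$ then $\Gamma;s\vdash u\,v\ \mathrm{wf}$; (Wf-Rule) if $\Gamma;s\vdash u\ \mathrm{wf}$, $\Gamma;s\vdash t\ \mathrm{wf}$ and $\Gamma;s\vdash u\leq t$ then $\Gamma;s\vdash u\leq_{\mathrm{wf}}t$; (Wf-Sub) $\Gamma;s\vdash v\leq_{\mathrm{wf}}t$ gives $\Gamma;s\vdash v\leq^*_{\mathrm{wf}}t$; (Wf-Trans) if $\Gamma;s\vdash v\leq^*_{\mathrm{wf}}u$, $\Gamma;s\vdash u\leq^*_{\mathrm{wf}}t$ and $\Gamma;s\vdash u\ \mathrm{wf}$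 then $\Gamma;s\vdash v\leq^*_{\mathrm{wf}}t$. *)

(* Defs.v *)
From Stdlib Require Import List Arith.
Import ListNotations.

Set Implicit Arguments.

Definition var := nat.

(* Terms whose free variables are named by V, quotiented by renaming of bound
   variables: the body of an abstraction has one more variable, [None]. *)
Inductive tm (V : Type) : Type :=
| Var (x : V)
| Top
| Lam (t : tm V) (u : tm (option V))
| App (u v : tm V).

Arguments Top {V}.

Fixpoint rename (V W : Type) (f : V -> W) (t : tm V) : tm W :=
  match t with
  | Var x => Var (f x)
  | Top => Top
  | Lam t u => Lam (rename f t) (rename (option_map f) u)
  | App u v => App (rename f u) (rename f v)
  end.

Fixpoint bind (V W : Type) (f : V -> tm W) (t : tm V) : tm W :=
  match t with
  | Var x => f x
  | Top => Top
  | Lam t u =>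
      Lam (bind f t)
          (bind (fun o => match o with
                          | None => Var None
                          | Some x => rename (@Some W) (f x)
                          end) u)
  | App u v => App (bind f u) (bind f v)
  end.

Fixpoint fv (V : Type) (t : tm V) : list V :=
  match t with
  | Var x => [x]
  | Top => []
  | Lam t u =>
      fv t ++ flat_map (fun o => match o with
                                 | None => []
                                 | Some x => [x]
                                 end) (fv u)
  | App u v => fv u ++ fv v
  end.

Definition term := tm var.

(* [lam x t u] is the term written \lambda x <= t. u; binding the name [x] in
   [u] turns its free occurrences into [None]. *)
Definition lam (x : var) (t u : term) : term :=
  Lam t (rename (fun y => if Nat.eqb y x then None else Some y) u).

(* [subst x v u] is u[x := v]. *)
Definition subst (x : var) (v u : term) : term :=
  bind (fun y => if Nat.eqb y x then v else Var y) u.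

(* Contexts grow at the head: \Gamma, x <= t is [(x, t) :: G], so the last
   annotation for a variable is the first one met from the head. *)
Definition ctx := list (var * term).
Definition stack := list term.

Definition dom (G : ctx) : list var := map fst G.

Fixpoint subtype_of (G : ctx) (x : var) : option term :=
  match G with
  | [] => None
  | (y, t) :: G => if Nat.eqb y x then Some t else subtype_of G x
  end.

Inductive prevalid : ctx -> stack -> Prop :=
| prevalid_nil : prevalid [] []
| prevalid_annot G x t :
    prevalid G [] -> ~ In x (dom G) -> incl (fv t) (dom G) ->
    prevalid ((x, t) :: G) []
| prevalid_push G a s :
    prevalid G s -> incl (fv a) (dom G) ->
    prevalid G (a :: s).

Inductive eqred : term -> term -> Prop :=
| eqred_var x : eqred (Var x) (Var x)
| eqred_top : eqred Top Top
| eqred_topapp u : eqred (App Top u) Top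
| eqred_app u u' v v' :
    eqred u u' -> eqred v v' -> eqred (App u v) (App u' v')
| eqred_beta x t u u' v v' :
    eqred u u' -> eqred v v' -> eqred (App (lam x t u) v) (subst x v' u')
| eqred_lam x t t' u u' :
    eqred t t' -> eqred u u' -> eqred (lam x t u) (lam x t' u').

Inductive subred : ctx -> stack -> term -> term -> Prop :=
| subred_prom G s x t :
    prevalid G s -> In (x, t) G -> subred G s (Var x) t
| subred_top G s u :
    prevalid G s -> subred G s u Top
| subred_eq G s u v :
    prevalid G s -> eqred u v -> subred G s u v
| subred_app G s u u' v :
    subred G (v :: s) u u' -> subred G s (App u v) (App u' v)
| subred_funop G s x a t u u' :
    subred ((x, a) :: G) s u u' ->
    subred G (a :: s) (lam x t u) (lam x t u')
| subred_fun G x t u u' :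
    subred ((x, t) :: G) [] u u' ->
    subred G [] (lam x t u) (lam x t u').

Inductive sub (G : ctx) (s : stack) : term -> term -> Prop :=
| sub_refl t : prevalid G s -> sub G s t t
| sub_left v v' t : subred G s v v' -> sub G s v' t -> sub G s v t
| sub_right v t t' : sub G s v t' -> eqred t t' -> sub G s v t.

(* [wf], [wsub] and [twsub] are well-formedness, <=_wf and <=^*_wf. *)
Inductive wf : ctx -> stack -> term -> Prop :=
| wf_var G s x t :
    prevalid G s -> subtype_of G x = Some t -> wf G s t -> wf G s (Var x)
| wf_top G s :
    prevalid G s -> wf G s Top
| wf_fun G x t u :
    wf ((x, t) :: G) [] u -> wf G [] t -> wf G [] (lam x t u)
| wf_funop G s x d t u :
    wf ((x, d) :: G) s u -> wf G [] t -> wf G (d :: s) (lam x t u)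
| wf_app G s x t u v :
    twsub G (v :: s) u (lam x t Top) -> twsub G [] v t -> wf G s (App u v)
with wsub : ctx -> stack -> term -> term -> Prop :=
| wsub_rule G s u t :
    wf G s u -> wf G s t -> sub G s u t -> wsub G s u t
with twsub : ctx -> stack -> term -> term -> Prop :=
| twsub_sub G s v t :
    wsub G s v t -> twsub G s v t
| twsub_trans G s v u t :
    twsub G s v u -> twsub G s u t -> wf G s u -> twsub G s v t.

(* Main.v *)
From Stdlib Require Import List Arith.
Require Import Defs.
Import ListNotations.

Set Implicit Arguments.

(** Interpret terms in a graph (filter) model whose points are sets of finite
    types [ty]: [Top] denotes the full set, an abstraction only contains arrows,
    and [eqred] preserves denotations.  Under the empty environment, the
    property "[base] belongs to the denotation" is preserved upwards by
    subtyping: a subtyping step can only act on the head of the term, where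
    promotion either meets a free variable, whose denotation is empty, or
    replaces a variable bound in a redex by the very operand it stands for.
    [Top] has this property and abstractions do not. *)

Inductive ty : Type :=
| base
| arr (L : list ty) (a : ty).

Definition env (V : Type) := V -> ty -> Prop.

Definition env_le (V : Type) (r r' : env V) : Prop :=
  forall x a, r x a -> r' x a.

Definition env_cons (V : Type) (r : env V) (d : ty -> Prop) : env (option V) :=
  fun o => match o with None => d | Some x => r x end.

Definition env_upd (r : env var) (x : var) (d : ty -> Prop) : env var :=
  fun y => if Nat.eqb y x then d else r y.

(* [Top] is absorbing for application, hence contains every arrow into one of
   its elements, i.e. every type. *)
Fixpoint interp (V : Type) (t : tm V) (r : env V) (a : ty) : Prop :=
  match t with
  | Var x => r x a
  | Top => True
  | Lam _ u =>
      match a with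
      | base => False
      | arr L b => interp u (env_cons r (fun c => In c L)) b
      end
  | App u v => exists L, interp u r (arr L a) /\ forall c, In c L -> interp v r c
  end.

Lemma interp_mono (V : Type) (t : tm V) (r r' : env V) (a : ty) :
  env_le r r' -> interp t r a -> interp t r' a.
Proof.
  revert r r' a; induction t as [V x| V | V t _ u IHu| V u IHu v IHv];
    intros r r' a Hr; simpl; auto.
  - destruct a as [|L b]; auto.
    apply IHu. intros [x|] c; simpl; auto.
  - intros [L [Hu Hv]]. exists L; split; eauto.
Qed.

Lemma interp_ext (V : Type) (t : tm V) (r r' : env V) (a : ty) :
  (forall x b, r x b <-> r' x b) -> interp t r a <-> interp t r' a.
Proof.
  intros Hr; split; apply interp_mono; intros x b; apply Hr.
Qed.

Lemma interp_rename (V W : Type) (f : V -> W) (t : tm V) (r : env W) (a : ty) :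
  interp (rename f t) r a <-> interp t (fun x => r (f x)) a.
Proof.
  revert W f r a; induction t as [V x| V | V t _ u IHu| V u IHu v IHv];
    intros W f r a; simpl; try tauto.
  - destruct a as [|L b]; [tauto|].
    rewrite IHu. apply interp_ext. intros [x|] c; simpl; tauto.
  - split; intros [L [Hu Hv]]; exists L; split; try apply IHu; auto;
      intros c Hc; apply IHv; auto.
Qed.

Lemma interp_bind (V W : Type) (f : V -> tm W) (t : tm V) (r : env W) (a : ty) :
  interp (bind f t) r a <-> interp t (fun x => interp (f x) r) a.
Proof.
  revert W f r a; induction t as [V x| V | V t _ u IHu| V u IHu v IHv];
    intros W f r a; simpl; try tauto.
  - destruct a as [|L b]; [tauto|].
    rewrite IHu. apply interp_ext. intros [x|] c; simpl; [|tauto].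
    rewrite interp_rename. apply interp_ext. simpl; tauto.
  - split; intros [L [Hu Hv]]; exists L; split; try apply IHu; auto;
      intros c Hc; apply IHv; auto.
Qed.

Definition fin_env (V : Type) (l : list (V * ty)) : env V :=
  fun x a => In (x, a) l.

Lemma fin_env_app (V : Type) (l l' : list (V * ty)) (r : env V) :
  env_le (fin_env l) r -> env_le (fin_env l') r -> env_le (fin_env (l ++ l')) r.
Proof.
  intros H H' x a Hin. apply in_app_or in Hin as [Hin|Hin]; [apply H|apply H']; auto.
Qed.

(** Continuity: arrows have finite lists as sources, so membership of [a] consults the environment
    at finitely many points only. *)
Lemma interp_compact (V : Type) (t : tm V) (r : env V) (a : ty) :
  interp t r a -> exists l, env_le (fin_env l) r /\ interp t (fin_env l) a.
Proof.
  revert r a; induction t as [V x| V | V t _ u IHu| V u IHu v IHv];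
    intros r a; simpl.
  - intros H. exists [(x, a)]; split; [|left; reflexivity].
    intros y b [E|[]]; inversion E; subst; auto.
  - intros _. exists []; split; auto. intros x b [].
  - destruct a as [|L b]; [tauto|]. intros H.
    destruct (IHu _ _ H) as [l [Hl Hu]].
    (* Pairs at the bound variable are dropped, since [env_cons] supplies the types of [L] there. *)
    exists (flat_map (fun p => match p with
                               | (Some x, c) => [(x, c)]
                               | (None, _) => []
                               end) l); split.
    + intros x c Hin. apply in_flat_map in Hin as [[[y|] d] [Hin E]]; [|destruct E].
      destruct E as [E|[]]; inversion E; subst. apply (Hl (Some x)); auto.
    + revert Hu; apply interp_mono. intros [x|] c Hin; simpl.
      * apply in_flat_map. exists (Some x, c); split; simpl; auto.
      * apply (Hl None); auto.
  - intros [L [Hu Hv]].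
    destruct (IHu _ _ Hu) as [l [Hl Hu']].
    assert (Hfin : exists l', env_le (fin_env l') r /\
              forall c, In c L -> interp v (fin_env l') c).
    { clear Hu Hu'. induction L as [|c L IHL].
      - exists []; split; [intros x b []|intros c []].
      - destruct IHL as [l1 [H1 H1']]; [intros; apply Hv; simpl; auto|].
        destruct (IHv r c) as [l2 [H2 H2']]; [apply Hv; simpl; auto|].
        exists (l1 ++ l2); split; [apply fin_env_app; auto|].
        intros d [<-|Hd]; [revert H2'|generalize (H1' d Hd)]; apply interp_mono;
          intros x b Hin; apply in_or_app; auto. }
    destruct Hfin as [l' [Hl' Hv']].
    exists (l ++ l'); split; [apply fin_env_app; auto|].
    exists L; split; [revert Hu'|intros c Hc; generalize (Hv' c Hc)];
      apply interp_mono; intros x b Hin; apply in_or_app; auto.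
Qed.

(** Links the two sides of beta: substitution binds [x] to a possibly infinite denotation,
    application passes only a finite list [L]. *)
Lemma interp_upd_compact (u : term) (r : env var) (x : var) (d : ty -> Prop) (a : ty) :
  interp u (env_upd r x d) a <->
  exists L, interp u (env_upd r x (fun c => In c L)) a /\ forall c, In c L -> d c.
Proof.
  split.
  - intros H. destruct (interp_compact u _ _ H) as [l [Hl Hu]].
    exists (map snd (filter (fun p => Nat.eqb (fst p) x) l)); split.
    + revert Hu; apply interp_mono. intros y c Hin.
      pose proof (Hl y c Hin) as Hy. unfold env_upd in *.
      destruct (Nat.eqb y x) eqn:E; auto.
      apply in_map_iff. exists (y, c); split; auto. apply filter_In; auto.
    + intros c Hc. apply in_map_iff in Hc as [[y c'] [Hc Hin]]. simpl in Hc; subst.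
      apply filter_In in Hin as [Hin E]. simpl in E.
      pose proof (Hl y c Hin) as Hy. unfold env_upd in Hy. rewrite E in Hy. auto.
  - intros [L [Hu HL]]. revert Hu; apply interp_mono. intros y c.
    unfold env_upd. destruct (Nat.eqb y x); auto.
Qed.

Lemma interp_lam (x : var) (t u : term) (r : env var) (L : list ty) (a : ty) :
  interp (lam x t u) r (arr L a) <-> interp u (env_upd r x (fun c => In c L)) a.
Proof.
  simpl. rewrite interp_rename. apply interp_ext. intros y b.
  unfold env_upd. destruct (Nat.eqb y x); simpl; tauto.
Qed.

Lemma interp_subst (x : var) (v u : term) (r : env var) (a : ty) :
  interp (subst x v u) r a <-> interp u (env_upd r x (interp v r)) a.
Proof.
  unfold subst. rewrite interp_bind. apply interp_ext. intros y b.
  unfold env_upd. destruct (Nat.eqb y x); simpl; tauto.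
Qed.

Lemma interp_eqred (u u' : term) :
  eqred u u' -> forall r a, interp u r a <-> interp u' r a.
Proof.
  induction 1 as [x| |u|u u' v v' _ IHu _ IHv|x t u u' v v' _ IHu _ IHv
                 |x t t' u u' _ _ _ IHu]; intros r a; try tauto.
  (* [Top] contains [arr [] a], which demands nothing of the operand. *)
  - simpl; split; auto. intros _. exists []; split; auto. intros c [].
  - simpl; split; intros [L [Hu Hv]]; exists L; split; try apply IHu; auto;
      intros c Hc; apply IHv; auto.
  - rewrite interp_subst, <- IHu, interp_upd_compact.
    change (interp (App (lam x t u) v) r a) with
      (exists L, interp (lam x t u) r (arr L a) /\ forall c, In c L -> interp v r c).
    split; intros [L [Hu Hv]]; exists L; split; try (apply interp_lam in Hu; exact Hu);
      try (apply interp_lam; exact Hu); intros c Hc; apply IHv; auto.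
  - destruct a as [|L b]; [simpl; tauto|]. rewrite !interp_lam. apply IHu.
Qed.

(* The arguments demanded by [a] are supplied by a prefix of the stack. *)
Fixpoint stack_fits (r : env var) (s : stack) (a : ty) : Prop :=
  match a with
  | base => True
  | arr L b =>
      match s with
      | [] => False
      | v :: s => (forall c, In c L -> interp v r c) /\ stack_fits r s b
      end
  end.

Lemma stack_fits_mono (r r' : env var) (s : stack) (a : ty) :
  env_le r r' -> stack_fits r s a -> stack_fits r' s a.
Proof.
  intros Hr. revert s; induction a as [|L b IH]; intros [|v s]; simpl; auto.
  intros [Hv Hs]; split; auto. intros c Hc; generalize (Hv c Hc); apply interp_mono; auto.
Qed.

(* Variables outside the domain get the empty denotation, so that extending the
   context only enlarges the environment, even if the new name occurs in the
   stack. *)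
Definition env_fits (r : env var) (G : ctx) : Prop :=
  (forall x t a, In (x, t) G -> r x a -> interp t r a) /\
  (forall x a, r x a -> In x (dom G)).

(** Freshness makes [r] empty at [x], so overwriting enlarges it; monotonicity then carries all
    bounds over. *)
Lemma env_fits_cons (r : env var) (G : ctx) (x : var) (t : term) (d : ty -> Prop) :
  env_fits r G -> ~ In x (dom G) -> (forall a, d a -> interp t r a) ->
  env_le r (env_upd r x d) /\ env_fits (env_upd r x d) ((x, t) :: G).
Proof.
  intros [Hin Hdom] Hx Hd.
  assert (Hle : env_le r (env_upd r x d)).
  { intros y a Hy. unfold env_upd. destruct (Nat.eqb_spec y x); auto.
    subst. destruct Hx; eauto. }
  split; auto. split.
  - intros y t' a [E|Hy] Ha; apply (interp_mono _ _ Hle).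
    + inversion E; subst. unfold env_upd in Ha. rewrite Nat.eqb_refl in Ha. auto.
    + unfold env_upd in Ha. destruct (Nat.eqb_spec y x); [|eauto].
      subst. destruct Hx. apply (in_map fst _ _ Hy).
  - intros y a Ha. unfold env_upd in Ha. simpl.
    destruct (Nat.eqb_spec y x); [auto|]. right; eauto.
Qed.

Lemma prevalid_NoDup (G : ctx) (s : stack) : prevalid G s -> NoDup (dom G).
Proof.
  induction 1; simpl; auto; constructor; auto.
Qed.

(** Prevalidity at the leaves of a derivation yields distinct names; this gives the freshness needed
    in the (FunOp) case. *)
Lemma subred_NoDup (G : ctx) (s : stack) (u u' : term) :
  subred G s u u' -> NoDup (dom G).
Proof.
  induction 1; eauto using prevalid_NoDup; simpl in *;
    eapply NoDup_cons_iff; eauto.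
Qed.

(** Generalised from [base] to all types whose arguments the stack supplies, so that induction goes
    through: (App) turns [a] into [arr L a] while pushing the operand, and (FunOp) consumes it. *)
Lemma subred_interp (G : ctx) (s : stack) (u u' : term) :
  subred G s u u' ->
  forall r a, env_fits r G -> stack_fits r s a -> interp u r a -> interp u' r a.
Proof.
  induction 1 as [G s x t _ Hx|G s u _|G s u v _ Huv|G s u u' v _ IH
                 |G s x b t u u' Hsub IH|G x t u u' _ _];
    intros r a Hr Hs Hu.
  - apply (proj1 Hr x _ _ Hx); auto.
  - exact I.
  - apply (interp_eqred Huv); auto.
  - destruct Hu as [L [Hu Hv]]. exists L; split; auto.
    apply IH; simpl; auto.
  - destruct a as [|L a]; [destruct Hu|]. destruct Hs as [HL Hs].
    apply interp_lam. apply interp_lam in Hu.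
    apply subred_NoDup in Hsub. apply NoDup_cons_iff in Hsub as [Hx _].
    (* [x] receives the types of [L], all of which belong to the operand [b] that becomes its
       annotation. *)
    destruct (env_fits_cons x b _ Hr Hx HL) as [Hle Hr'].
    apply IH; auto. apply (stack_fits_mono _ _ Hle); auto.
  (* The empty stack fits only [base], which no abstraction contains. *)
  - destruct a; [destruct Hu|destruct Hs].
Qed.

Definition empty_env : env var := fun _ _ => False.

Lemma sub_interp_base (G : ctx) (s : stack) (u t : term) :
  sub G s u t -> interp u empty_env base -> interp t empty_env base.
Proof.
  induction 1 as [t _|v v' t Hv _ IH|v t t' _ IH Ht]; intros Hu; auto.
  - apply IH. apply (subred_interp Hv); [| |exact Hu].
    (* The empty environment fits every context, and [base], demanding no argument, fits every
       stack. *)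
    + split; [intros x t0 a _ []|intros x a []].
    + destruct s; exact I.
  - apply (interp_eqred Ht); auto.
Qed.

Lemma twsub_interp_base (G : ctx) (s : stack) (u t : term) :
  twsub G s u t -> interp u empty_env base -> interp t empty_env base.
Proof.
  induction 1 as [G s u t H|]; auto.
  destruct H as [G s u t _ _ H]. apply (sub_interp_base H).
Qed.

Theorem theorem4p3 (G : ctx) (s : stack) (x : var) (t u : term) :
  ~ twsub G s Top (lam x t u).
Proof.
  (* At [base], [interp] computes to [True] on [Top] and to [False] on an abstraction. *)
  intros H. exact (twsub_interp_base H I).
Qed.
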